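(* Let $R$ be a Noetherian normal domain of dimension $\geq 2$, $M$ a finitely generated reflexive $R$-module, and $\varphi:R^{s}\to M$ an $R$-module homomorphism. Let $0\to M\xrightarrow{\iota}F\to X\to 0$ be an exact sequence of $R$-modules with $F$ finitely generated free and $X$ torsionfree. Then the following conditions are equivalent: (i) the map $\varphi$ is injective and $\operatorname{Coker}(\varphi)$ is torsionfree; (ii) $\operatorname{height}(I_s(\iota\circ\varphi))\geq 2$.
   Context: A finitely generated $R$-module $N$ is torsionfree if $N\to\mathrm{Q}(R)\otimes_R N$ is injective, where $\mathrm{Q}(R)$ is the total ring of fractions, and reflexive if the canonical map $N\to N^{**}$ is bijective, where $(-)^*=\operatorname{Hom}_R(-,R)$. $I_t(\alpha)$ denotes the ideal generated by the $t$-minors of a matrix representing a homomorphism $\alpha$ of finitely generated free modules. The unit ideal has height $\infty$. *)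

(* Defs.v *)
From HB Require Import structures.
From mathcomp Require Import all_boot all_order all_algebra generic_quotient.
From mathcomp Require Import freeg boolp.

Set Implicit Arguments.
Unset Strict Implicit.
Unset Printing Implicit Defensive.

Import GRing.Theory.
Local Open Scope ring_scope.
Local Open Scope quotient_scope.

Local Notation "x %:F" := (FracField.tofrac x).

(* Ideals of R are submodules of R^o; they are allowed to be all of R, unlike
   the [idealr] of ring_quotient. *)

Section Generated.
Variables (R : comNzRingType) (V : lmodType R).

(* The submodule generated by the elements that satisfy G. *)
Definition gen_submod (G : V -> Prop) : {pred V} := fun x =>
  `[< exists s : seq (R * V),
        (forall p, p \in s -> G p.2) /\ x = \sum_(p <- s) p.1 *: p.2 >].

Variable G : V -> Prop.

Lemma gen_submod_nmod_closed : Algebra.nmod_closed (gen_submod G).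
Proof.
split; first by apply/asboolP; exists [::]; split => //; rewrite big_nil.
move=> x y /asboolP[s [Gs ->]] /asboolP[t [Gt ->]].
apply/asboolP; exists (s ++ t); split; last by rewrite big_cat.
by move=> p; rewrite mem_cat => /orP[/Gs|/Gt].
Qed.

Lemma gen_submod_scaler_closed : GRing.scaler_closed (gen_submod G).
Proof.
move=> a x /asboolP[s [Gs ->]].
apply/asboolP; exists [seq (a * p.1, p.2) | p <- s]; split.
  by move=> p /mapP[q /Gs Gq ->].
by rewrite big_map scaler_sumr; apply: eq_bigr => p _; rewrite scalerA.
Qed.

HB.instance Definition _ :=
  GRing.isAddClosed.Build V (gen_submod G) gen_submod_nmod_closed.
HB.instance Definition _ :=
  GRing.isScaleClosed.Build R V (gen_submod G) gen_submod_scaler_closed.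

End Generated.

Definition fin_gen (R : comNzRingType) (V : lmodType R) : Prop :=
  exists s : seq V, forall x : V, x \in gen_submod (fun y => y \in s).

Definition noetherian (R : comNzRingType) : Prop :=
  forall I : submodClosed R^o,
    exists s : seq R^o, I =i gen_submod (fun y => y \in s).

Definition normal_domain (R : idomainType) : Prop :=
  forall z : {fraction R},
    integralOver (@FracField.tofrac R) z -> exists r : R, z = r%:F.

(* Dimension and height take values in the natural numbers extended by oo; only
   the assertions "dimension >= k" and "height >= k" are defined. *)

Section Height.
Variable R : comNzRingType.

Definition prime_ideal (P : submodClosed R^o) : Prop :=
  (1 : R) \notin P /\ prime_idealr_closed (P : {pred R}).

(* P 0 < P 1 < ... < P k, the inclusions being strict *)
Definition prime_chain (k : nat) (P : nat -> submodClosed R^o) : Prop :=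
  (forall i, (i <= k)%N -> prime_ideal (P i)) /\
  (forall i, (i < k)%N ->
     {subset P i <= P i.+1} /\ ~ {subset P i.+1 <= P i}).

Definition krull_dim_ge (k : nat) : Prop := exists P, prime_chain k P.

Definition prime_height_ge (p : submodClosed R^o) (k : nat) : Prop :=
  exists P, prime_chain k P /\ P k =i p.

(* The height of I is the infimum of the heights of the primes containing I; it
   is oo for the unit ideal, which is contained in no prime. *)
Definition height_ge (I : submodClosed R^o) (k : nat) : Prop :=
  forall p : submodClosed R^o,
    prime_ideal p -> {subset I <= p} -> prime_height_ge p k.

End Height.

Section Quotient.
Variables (R : comNzRingType) (V : lmodType R) (S : submodClosed V).

Definition eqmodS : rel V := fun x y => x - y \in S.

Let rpredNS x : x \in S -> - x \in S.
Proof. by move=> Sx; rewrite -scaleN1r rpredZ. Qed.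

Lemma eqmodS_refl : reflexive eqmodS.
Proof. by move=> x; rewrite /eqmodS subrr rpred0. Qed.

Lemma eqmodS_sym : symmetric eqmodS.
Proof. by move=> x y; apply/idP/idP => /rpredNS; rewrite opprB. Qed.

Lemma eqmodS_trans : transitive eqmodS.
Proof.
by move=> y x z Sxy Syz; rewrite /eqmodS -(subrKA y) rpredD.
Qed.

Canonical eqmodS_equiv := EquivRel eqmodS eqmodS_refl eqmodS_sym eqmodS_trans.
Canonical eqmodS_encModRel := defaultEncModRel eqmodS.

Definition quotmod := {eq_quot eqmodS}.
HB.instance Definition _ := Choice.on quotmod.
HB.instance Definition _ : EqQuotient V eqmodS quotmod := EqQuotient.on quotmod.

Lemma pi_quotmod_eq (x y : V) :
  (\pi_quotmod x = \pi_quotmod y) <-> (x - y \in S).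
Proof. by split=> [/eqmodP|Sxy] //; apply/eqmodP. Qed.

Let reprS (x : V) : repr (\pi_quotmod x) - x \in S.
Proof. by apply/pi_quotmod_eq; rewrite reprK. Qed.

Definition quotmod_zero : quotmod := lift_cst quotmod 0.
Definition quotmod_opp := lift_op1 quotmod -%R.
Definition quotmod_add := lift_op2 quotmod +%R.
Definition quotmod_scale (a : R) := lift_op1 quotmod ( *:%R a).

Canonical pi_quotmod_zero_morph := PiConst quotmod_zero.

Lemma pi_quotmod_opp : {morph \pi_quotmod : x / - x >-> quotmod_opp x}.
Proof.
by move=> x; unlock quotmod_opp; apply/esym/pi_quotmod_eq; rewrite -opprD rpredNS.
Qed.
Canonical pi_quotmod_opp_morph := PiMorph1 pi_quotmod_opp.

Lemma pi_quotmod_add : {morph \pi_quotmod : x y / x + y >-> quotmod_add x y}.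
Proof.
move=> x y; unlock quotmod_add; apply/esym/pi_quotmod_eq.
by rewrite opprD addrACA rpredD.
Qed.
Canonical pi_quotmod_add_morph := PiMorph2 pi_quotmod_add.

Lemma pi_quotmod_scale a :
  {morph \pi_quotmod : x / a *: x >-> quotmod_scale a x}.
Proof.
move=> x; unlock quotmod_scale; apply/esym/pi_quotmod_eq.
by rewrite -scalerBr rpredZ.
Qed.
Canonical pi_quotmod_scale_morph a := PiMorph1 (pi_quotmod_scale a).

Fact quotmod_addA : associative quotmod_add.
Proof. by do 3 elim/quotW=> ?; rewrite !piE addrA. Qed.

Fact quotmod_addC : commutative quotmod_add.
Proof. by do 2 elim/quotW=> ?; rewrite !piE addrC. Qed.

Fact quotmod_add0 : left_id quotmod_zero quotmod_add.
Proof. by elim/quotW=> x; rewrite !piE add0r. Qed.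

Fact quotmod_addN : left_inverse quotmod_zero quotmod_opp quotmod_add.
Proof. by elim/quotW=> x; rewrite !piE addNr. Qed.

HB.instance Definition _ := GRing.isZmodule.Build quotmod
  quotmod_addA quotmod_addC quotmod_add0 quotmod_addN.

Fact quotmod_scaleA a b u :
  quotmod_scale a (quotmod_scale b u) = quotmod_scale (a * b) u.
Proof. by elim/quotW: u => x; rewrite !piE scalerA. Qed.

Fact quotmod_scale1 : left_id 1 quotmod_scale.
Proof. by elim/quotW=> x; rewrite !piE scale1r. Qed.

Fact quotmod_scaleDr : right_distributive quotmod_scale quotmod_add.
Proof. by move=> a; do 2 elim/quotW=> ?; rewrite !piE scalerDr. Qed.

Fact quotmod_scaleDl u : {morph quotmod_scale^~ u : a b / a + b}.
Proof.
elim/quotW: u => x a b; rewrite -[RHS]/(quotmod_add _ _) !piE.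
by rewrite scalerDl.
Qed.

HB.instance Definition _ := GRing.Zmodule_isLmodule.Build R quotmod
  quotmod_scaleA quotmod_scale1 quotmod_scaleDr quotmod_scaleDl.

Definition quotmod_proj (x : V) : quotmod := \pi_quotmod x.

Fact quotmod_proj_is_linear : linear quotmod_proj.
Proof.
move=> a x y; rewrite -[RHS]/(quotmod_add (quotmod_scale a _) _).
by rewrite /quotmod_proj !piE.
Qed.

HB.instance Definition _ := GRing.isLinear.Build R V quotmod _ quotmod_proj
  quotmod_proj_is_linear.

End Quotient.

Section Cokernel.
Variables (R : comNzRingType) (U V : lmodType R) (f : {linear U -> V}).

Definition image_submod : {pred V} := fun y => `[< exists x, f x = y >].

Lemma image_submod_nmod_closed : Algebra.nmod_closed image_submod.
Proof.
split; first by apply/asboolP; exists 0; rewrite raddf0.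
move=> _ _ /asboolP[x <-] /asboolP[y <-].
by apply/asboolP; exists (x + y); rewrite raddfD.
Qed.

Lemma image_submod_scaler_closed : GRing.scaler_closed image_submod.
Proof.
by move=> a _ /asboolP[x <-]; apply/asboolP; exists (a *: x); rewrite linearZ.
Qed.

HB.instance Definition _ :=
  GRing.isAddClosed.Build V image_submod image_submod_nmod_closed.
HB.instance Definition _ :=
  GRing.isScaleClosed.Build R V image_submod image_submod_scaler_closed.

Definition coker : lmodType R := quotmod image_submod.

End Cokernel.

Section Tensor.
Variables (R : comNzRingType) (A B : lmodType R).

(* {freeg (A * B) / R} is the free R-module with basis A * B, and << p >> is the
   basis vector of p. *)
Inductive tensor_rel : {freeg (A * B)%type / R} -> Prop :=
| TensorDl (a a' : A) (b : B) :
    tensor_rel (<< (a + a', b) >> - << (a, b) >> - << (a', b) >>)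
| TensorDr (a : A) (b b' : B) :
    tensor_rel (<< (a, b + b') >> - << (a, b) >> - << (a, b') >>)
| TensorZl (r : R) (a : A) (b : B) :
    tensor_rel (<< (r *: a, b) >> - r *: << (a, b) >>)
| TensorZr (r : R) (a : A) (b : B) :
    tensor_rel (<< (a, r *: b) >> - r *: << (a, b) >>).

Definition tensor : lmodType R := quotmod (gen_submod tensor_rel).

Definition tens (a : A) (b : B) : tensor :=
  quotmod_proj (gen_submod tensor_rel) << (a, b) >>.

End Tensor.

(* The total ring of fractions of a domain is its field of fractions, here with
   its structure of R-module. *)
Section FracModule.
Variable R : idomainType.

Definition fracmod := {fraction R}.
HB.instance Definition _ := GRing.Zmodule.on fracmod.

Definition fracmod_scale (a : R) (x : fracmod) : fracmod :=
  a%:F * (x : {fraction R}).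

Fact fracmod_scaleA a b x :
  fracmod_scale a (fracmod_scale b x) = fracmod_scale (a * b) x.
Proof. by rewrite /fracmod_scale mulrA tofracM. Qed.

Fact fracmod_scale1 : left_id 1 fracmod_scale.
Proof. by move=> x; rewrite /fracmod_scale tofrac1 mul1r. Qed.

Fact fracmod_scaleDr : right_distributive fracmod_scale +%R.
Proof. by move=> a x y; rewrite /fracmod_scale mulrDr. Qed.

Fact fracmod_scaleDl x : {morph fracmod_scale^~ x : a b / a + b}.
Proof. by move=> a b; rewrite /fracmod_scale tofracD mulrDl. Qed.

HB.instance Definition _ := GRing.Zmodule_isLmodule.Build R fracmod
  fracmod_scaleA fracmod_scale1 fracmod_scaleDr fracmod_scaleDl.

End FracModule.

Definition torsionfree (R : idomainType) (N : lmodType R) : Prop :=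
  injective (fun x : N => tens ((1 : {fraction R}) : fracmod R) x).

Section Dual.
Variables (R : comNzRingType) (U : lmodType R).

Definition dual := {linear U -> R^o}.

HB.instance Definition _ := gen_eqMixin dual.
HB.instance Definition _ := gen_choiceMixin dual.

Implicit Types f g h : dual.

Lemma dual_ext f g : f =1 g -> f = g.
Proof.
case: f g => [f [[af] [lf]]] [g [[ag] [lg]]] /= /funext fg.
rewrite fg in af lf *.
by rewrite (Prop_irrelevance af ag) (Prop_irrelevance lf lg).
Qed.

Definition dual_zero : dual := \0.
Definition dual_opp f : dual := \- f.
Definition dual_add f g : dual := f \+ g.
Definition dual_scale (a : R) f : dual := a \*: f.

Fact dual_addA : associative dual_add.
Proof. by move=> f g h; apply: dual_ext => x; apply: addrA. Qed.

Fact dual_addC : commutative dual_add.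
Proof. by move=> f g; apply: dual_ext => x; apply: addrC. Qed.

Fact dual_add0 : left_id dual_zero dual_add.
Proof. by move=> f; apply: dual_ext => x; apply: add0r. Qed.

Fact dual_addN : left_inverse dual_zero dual_opp dual_add.
Proof. by move=> f; apply: dual_ext => x; apply: addNr. Qed.

HB.instance Definition _ := GRing.isZmodule.Build dual
  dual_addA dual_addC dual_add0 dual_addN.

Fact dual_scaleA a b f : dual_scale a (dual_scale b f) = dual_scale (a * b) f.
Proof. by apply: dual_ext => x; apply: scalerA. Qed.

Fact dual_scale1 : left_id 1 dual_scale.
Proof. by move=> f; apply: dual_ext => x; apply: scale1r. Qed.

Fact dual_scaleDr : right_distributive dual_scale +%R.
Proof. by move=> a f g; apply: dual_ext => x; apply: scalerDr. Qed.

Fact dual_scaleDl f : {morph dual_scale^~ f : a b / a + b}.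
Proof. by move=> a b; apply: dual_ext => x; apply: scalerDl. Qed.

HB.instance Definition _ := GRing.Zmodule_isLmodule.Build R dual
  dual_scaleA dual_scale1 dual_scaleDr dual_scaleDl.

End Dual.

Section Reflexive.
Variables (R : comNzRingType) (U : lmodType R).

Definition dual_eval (x : U) (f : dual U) : R^o := f x.

Fact dual_eval_is_linear x : linear (dual_eval x).
Proof. by []. Qed.

HB.instance Definition _ x := GRing.isLinear.Build R (dual U) R^o _ (dual_eval x)
  (dual_eval_is_linear x).

Definition bidual_map (x : U) : dual (dual U) := dual_eval x.

Definition reflexive_module : Prop := bijective bidual_map.

End Reflexive.

Section FreeModules.
Variables (R : comNzRingType).

Definition is_basis (F : lmodType R) (n : nat) (e : 'I_n -> F) : Prop :=
  forall x : F, exists! c : 'rV[R]_n, x = \sum_j c 0 j *: e j.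

Definition fin_free (F : lmodType R) : Prop :=
  exists (n : nat) (e : 'I_n -> F), is_basis e.

(* Vectors are written as rows: row i of A holds the coordinates of f (d i). *)
Definition represents (F G : lmodType R) (m n : nat) (d : 'I_m -> F)
    (e : 'I_n -> G) (f : F -> G) (A : 'M[R]_(m, n)) : Prop :=
  [/\ is_basis d, is_basis e & forall i, f (d i) = \sum_j A i j *: e j].

Definition is_minor (t m n : nat) (A : 'M[R]_(m, n)) (a : R) : Prop :=
  exists (f : 'I_t -> 'I_m) (g : 'I_t -> 'I_n),
    [/\ {homo f : i j / (i < j)%N}, {homo g : i j / (i < j)%N}
      & a = \det (mxsub f g A)].

Definition det_ideal (t m n : nat) (A : 'M[R]_(m, n)) : submodClosed R^o :=
  gen_submod (is_minor t A : R^o -> Prop).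

End FreeModules.

Definition short_exact (R : comNzRingType) (U V W : lmodType R)
    (f : {linear U -> V}) (g : {linear V -> W}) : Prop :=
  [/\ injective f, (forall y, g y = 0 <-> exists x, f x = y)
    & forall z, exists y, g y = z].

(* Main.v *)
Require Import Defs.
From HB Require Import structures.
From mathcomp Require Import freeg.
From mathcomp Require Import all_boot all_order all_algebra.
From mathcomp Require Import fingroup perm generic_quotient boolp.

(** After choosing coordinates, [iota \o phi] is right multiplication of row
    vectors by A.  Because X is torsionfree, an element of F with a nonzero
    multiple in the image of phi already lies in M; so (i) says that the rows of
    A are independent and that their span is [saturated] in R^n.  Torsion is
    understood elementwise, through [torsionfreeP].

    Both implications rest on the denominator ideals D(q) = {z | z q in R} of
    the fractions q.  If R is Noetherian, some multiple c q has a prime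
    denominator ideal ([denom_ideal_prime]).  If R is also normal, a prime D(q)
    contains some t with u = t q outside D(q), since otherwise q D(q) would lie
    in D(q) and the determinant trick would make q integral.  For z in D(q) this
    gives u z = t (z q): locally at D(q), the element t generates D(q).

    (ii) => (i).  A prime D(q) has no nonzero prime P1 strictly below it: such a
    P1 would be stable under q, and q would be integral again.  Hence an ideal I
    of height at least 2 with q I in R forces q in R ([height2_denom]).  If
    r y = c A with r nonzero, Cramer's rule says that every s-minor of A
    multiplies the fractions c_i / r into R.  So c = r c' with c' over R, and
    y = c' A.  Some minor is nonzero, and Cramer's rule shows that the rows are
    independent.

    (i) => (ii).  Let P be a prime that contains all s-minors.  Modulo P the rows
    of A are dependent: there is x with an entry outside P such that x A has all
    its entries in P ([minors_in_prime]).  Independence of the rows then makes P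
    nonzero.  For a nonzero a in P, some multiple q of 1 / a has a prime
    denominator ideal that contains a and lies in P.  If it is smaller than P,
    then 0, D(q), P is the required chain.  If P = D(q), take t and u as above:
    u x A is divisible by t, so saturation and independence give u x = t c', and
    all u x_i lie in P, which contradicts the choice of u and x. *)

Set Implicit Arguments.
Unset Strict Implicit.
Unset Printing Implicit Defensive.

Import GRing.Theory.
Local Open Scope ring_scope.
Local Open Scope quotient_scope.

Local Notation "x %:F" := (FracField.tofrac x).

(** * Submodules given by generators *)

Section GeneratedSubmodule.
Variables (R : comNzRingType) (V : lmodType R).

Lemma mem_gen_submod (G : V -> Prop) x : G x -> x \in gen_submod G.
Proof.
move=> Gx; apply/asboolP; exists [:: (1, x)].
by rewrite big_seq1 scale1r; split=> // p; rewrite inE => /eqP->.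
Qed.

Lemma gen_submod_sub (G : V -> Prop) (P : submodClosed V) :
  (forall x, G x -> x \in P) -> {subset gen_submod G <= P}.
Proof.
move=> GP x /asboolP[t [Gt ->]]; rewrite big_seq; apply: rpred_sum => p /Gt /GP.
exact: rpredZ.
Qed.

Lemma gen_submod_seqP (t : seq V) x : x \in gen_submod (fun y => y \in t) ->
  exists c : 'rV[R]_(size t), x = \sum_j c 0 j *: t`_j.
Proof.
case/asboolP=> u [ut ->]; elim: u ut => [|[a y] u IHu] ut.
  by exists 0; rewrite big_nil big1 // => j _; rewrite mxE scale0r.
have [|c sum_u] := IHu; first by move=> p pu; apply: ut; rewrite inE pu orbT.
have ty : (index y t < size t)%N by rewrite index_mem (ut (a, y)) ?mem_head.
exists (a *: delta_mx 0 (Ordinal ty) + c).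
rewrite big_cons sum_u -[in LHS](nth_index 0 (ut (a, y) (mem_head _ _))) /=.
under [RHS]eq_bigr => j _ do rewrite mxE scalerDl.
rewrite big_split; congr (_ + _).
rewrite (bigD1 (Ordinal ty)) //= big1 ?addr0; first by rewrite !mxE !eqxx mulr1.
by move=> j /negPf ne; rewrite !mxE ne andbF mulr0 scale0r.
Qed.

End GeneratedSubmodule.

(** * Maximal elements of families of ideals *)

Section Noetherian.
Variable R : comNzRingType.
Implicit Types I J : submodClosed R^o.

Lemma ideal_mull I (a x : R) : (x : R^o) \in I -> (a * x : R^o) \in I.
Proof. exact: rpredZ. Qed.

Lemma ideal_mulr I (a x : R) : (x : R^o) \in I -> (x * a : R^o) \in I.
Proof. by rewrite mulrC; apply: ideal_mull. Qed.

(** Without a maximal element, dependent choice gives a strictly increasing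
    sequence of ideals; finitely many generators of the union already lie in one
    term, where the sequence must stop. *)
Lemma noetherian_maximal (Q : submodClosed R^o -> Prop) I0 :
  noetherian R -> Q I0 ->
  exists I, Q I /\ forall J, Q J -> {subset I <= J} -> {subset J <= I}.
Proof.
move=> noethR QI0; apply: contrapT => noMax.
have step (I : {I | Q I}) : exists J : {J | Q J},
    {subset sval I <= sval J} /\ ~ {subset sval J <= sval I}.
  case: I => I QI; apply: contrapT => noJ; apply: noMax; exists I; split=> //.
  move=> J QJ IJ; apply: contrapT => nJI; apply: noJ.
  by exists (exist _ J QJ).
have [next nextP] := choice step.
pose u n := sval (iter n next (exist _ I0 QI0)).
have uS n : {subset u n <= u n.+1} by case: (nextP (iter n next (exist _ I0 QI0))).
have uM m n : (m <= n)%N -> {subset u m <= u n}.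
  move=> /subnK<-; elim: (n - m)%N => // k IHk x /IHk; exact: uS.
pose U x := exists n, x \in u n.
have [t Ut] := noethR (gen_submod U : submodClosed R^o).
have fin (v : seq R^o) : (forall x, x \in v -> exists n, x \in u n) ->
    exists N, forall x, x \in v -> x \in u N.
  elim: v => [|y v IHv] vu; first by exists 0%N.
  have [|N vN] := IHv; first by move=> x xv; apply: vu; rewrite inE xv orbT.
  have [n yn] := vu y (mem_head _ _).
  exists (maxn n N) => x; rewrite inE => /predU1P[->|/vN].
    exact: uM (leq_maxl _ _) _ yn.
  exact: uM (leq_maxr _ _) _.
have UuN x : x \in gen_submod U -> exists n, x \in u n.
  case/asboolP=> v [Uv ->].
  have [|N vN] := fin [seq p.2 | p <- v].
    by move=> y /mapP[p /Uv ? ->].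
  exists N; rewrite big_seq; apply: rpred_sum => p pv.
  by apply: rpredZ; apply: vN; apply: map_f.
have [N tN] : exists N, forall x, x \in t -> x \in u N.
  by apply: fin => x xt; apply: UuN; rewrite Ut mem_gen_submod.
case: (nextP (iter N next (exist _ I0 QI0))) => _; apply=> x xN.
have: x \in gen_submod U by apply: mem_gen_submod; exists N.+1.
rewrite Ut; exact: gen_submod_sub.
Qed.

End Noetherian.

(** * Denominator ideals of fractions *)

Section Denominators.
Variable R : idomainType.
Implicit Types (q : {fraction R}) (P I : submodClosed R^o).

Lemma frac_denominator q : exists2 b : R, b != 0 & exists a : R, b%:F * q = a%:F.
Proof.
elim/quotW: q => r; exists \d_r; first exact: denom_ratioP.
exists \n_r; unlock FracField.tofrac; rewrite -[LHS]FracField.pi_mul.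
apply/eqmodP; rewrite /= FracField.equivfE /FracField.mulf.
by rewrite !numden_Ratio ?(oner_eq0, mulf_neq0, denom_ratioP) // ?mul1r ?mulr1 mulrC.
Qed.

Section DenominatorIdeal.
Variable q : {fraction R}.

Definition denom_ideal : {pred R^o} :=
  fun z => `[< exists r : R, (z : R)%:F * q = r%:F >].

Lemma denom_idealP (z : R) :
  reflect (exists r : R, z%:F * q = r%:F) ((z : R^o) \in denom_ideal).
Proof. exact: asboolP. Qed.

Lemma denom_ideal_nmod_closed : Algebra.nmod_closed denom_ideal.
Proof.
split; first by apply/denom_idealP; exists 0; rewrite rmorph0 mul0r.
move=> x y /denom_idealP[a xa] /denom_idealP[b yb]; apply/denom_idealP.
by exists (a + b); rewrite !rmorphD mulrDl xa yb.
Qed.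

Lemma denom_ideal_scaler_closed : GRing.scaler_closed denom_ideal.
Proof.
move=> a x /denom_idealP[b xb]; apply/denom_idealP.
by exists (a * b); rewrite !rmorphM -mulrA xb.
Qed.

HB.instance Definition _ :=
  GRing.isAddClosed.Build R^o denom_ideal denom_ideal_nmod_closed.
HB.instance Definition _ :=
  GRing.isScaleClosed.Build R R^o denom_ideal denom_ideal_scaler_closed.

End DenominatorIdeal.

Lemma denom_ideal_mul q (c z : R) :
  ((z : R^o) \in denom_ideal (c%:F * q)) = ((z * c : R^o) \in denom_ideal q).
Proof.
by apply/denom_idealP/denom_idealP=> -[r rE]; exists r; move: rE;
   rewrite rmorphM mulrA.
Qed.

Lemma denom_ideal1 q : ((1 : R^o) \in denom_ideal q) <-> exists r, q = r%:F.
Proof.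
by split=> [/denom_idealP|] [r rE]; [|apply/denom_idealP]; exists r;
   move: rE; rewrite rmorph1 mul1r.
Qed.

(** This is the existence of associated primes of Frac(R)/R, localized at the
    multiplicative set S: an ideal that is maximal among the D(c q) missing S is
    prime.  Indeed if x y is in D(c q), then x is in D(y c q), which contains
    D(c q); either D(y c q) misses S and maximality puts x in D(c q), or some u
    in S lies in D(y c q), and then y is in D(u c q), which misses S and so
    equals D(c q).  The sets S = {1} and S = R \ P are both needed below. *)
Lemma denom_ideal_prime (S : R -> Prop) q : noetherian R ->
    S 1 -> (forall x y, S x -> S y -> S (x * y)) ->
    (forall z : R, (z : R^o) \in denom_ideal q -> ~ S z) ->
  exists c : R, prime_ideal (denom_ideal (c%:F * q)) /\
    forall z : R, (z : R^o) \in denom_ideal (c%:F * q) -> ~ S z.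
Proof.
move=> noethR S1 SM disj.
pose Q I := exists c : R, I =i denom_ideal (c%:F * q) /\
  forall z : R, (z : R^o) \in I -> ~ S z.
have [|I [[c [Ic disjI]] maxI]] := @noetherian_maximal R Q (denom_ideal q) noethR.
  by exists 1; split=> // z; rewrite rmorph1 mul1r.
exists c; split; last by move=> z; rewrite -Ic; apply: disjI.
split; first by rewrite -Ic; apply/negP => /disjI.
move=> x y; rewrite -!Ic => xyI; rewrite -implyNb; apply/implyP => yI.
have maxD (a z : R) :
    (forall z : R, (z : R^o) \in denom_ideal ((a * c)%:F * q) -> ~ S z) ->
    (z * a : R^o) \in I -> (z : R^o) \in I.
  move=> disja zaI; apply: (maxI (denom_ideal ((a * c)%:F * q))).
  - by exists (a * c).
  - move=> w; rewrite Ic !denom_ideal_mul mulrCA; apply: ideal_mull.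
  - by rewrite denom_ideal_mul mulrA -denom_ideal_mul -Ic.
apply: (maxD x); last by rewrite mulrC.
move=> u xu Su; move/negP: yI; apply.
apply: (maxD u) => [w|].
  rewrite denom_ideal_mul mulrA -denom_ideal_mul -Ic => /disjI nS Sw.
  by apply: nS; apply: SM.
by move: xu; rewrite denom_ideal_mul mulrA -denom_ideal_mul -Ic mulrC.
Qed.

(** The determinant trick: multiplication by q acts on generators of P through a
    matrix over R, of which q is an eigenvalue because P is nonzero; so q is a
    root of the characteristic polynomial, and normality applies. *)
Lemma integral_of_stable_ideal P q : noetherian R -> normal_domain R ->
    (exists2 z : R, (z : R^o) \in P & z != 0) ->
    (forall z : R, (z : R^o) \in P ->
       exists2 w : R, (w : R^o) \in P & z%:F * q = w%:F) ->
  exists r, q = r%:F.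
Proof.
move=> noethR normR [z0 z0P nz0] stable; apply: normR.
have [t Pt] := noethR P.
have tP (i : 'I_(size t)) : (t`_i : R^o) \in P.
  by rewrite Pt mem_gen_submod ?mem_nth.
have row (i : 'I_(size t)) : exists c : 'rV[R]_(size t),
    (t`_i : R)%:F * q = (\sum_j c 0 j * t`_j)%:F.
  have [w wP ->] := stable _ (tP i).
  by move: wP; rewrite Pt => /gen_submod_seqP[c ->]; exists c.
have [B BE] := choice row.
pose M : 'M[R]_(size t) := \matrix_(j, i) B i 0 j.
exists (char_poly M); first exact: char_poly_monic.
rewrite map_char_poly -eigenvalue_root_char; apply/eigenvalueP.
exists (\row_j (t`_j : R)%:F).
  apply/rowP=> i; rewrite !mxE mulrC BE rmorph_sum.
  by apply: eq_bigr => j _; rewrite !mxE rmorphM mulrC.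
apply: contra_neq nz0 => v0.
move: z0P; rewrite Pt => /gen_submod_seqP[c ->]; apply: big1 => j _.
move/rowP/(_ j): v0; rewrite !mxE => /eqP; rewrite tofrac_eq0 => /eqP->.
exact: mulr0.
Qed.

End Denominators.

(** * Heights and denominator ideals in a normal domain *)

Section Height.
Variable R : idomainType.
Implicit Types (q : {fraction R}) (P I : submodClosed R^o).

(** The pair (t, u) says that D(q) becomes principal, generated by t = u / q,
    once u is inverted. *)
Lemma prime_denom_uniformizer q : noetherian R -> normal_domain R ->
    prime_ideal (denom_ideal q) ->
  exists t u : R, [/\ (t : R^o) \in denom_ideal q,
                      (u : R^o) \notin denom_ideal q & t%:F * q = u%:F].
Proof.
move=> noethR normR [/negP D1 _]; apply: contrapT => noTU; apply: D1.
apply/denom_ideal1/(@integral_of_stable_ideal R (denom_ideal q)) => //.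
  by have [b nzb Db] := frac_denominator q; exists b => //; apply/denom_idealP.
move=> z Dz; have /denom_idealP[w zw] := Dz; exists w => //.
by apply: contrapT => /negP Dw; apply: noTU; exists z, w.
Qed.

Lemma uniformizer_generates q (t u z w : R) :
  t%:F * q = u%:F -> z%:F * q = w%:F -> u * z = t * w.
Proof.
move=> tu zw; apply/eqP; rewrite -tofrac_eq !tofracM -tu -zw.
by rewrite mulrAC -mulrA.
Qed.

(** A prime denominator ideal has height at most 1: a nonzero prime P1 strictly
    below D(q) would not contain t, whereas u z = t (z q) lies in P1 for z in P1,
    so that q P1 would lie in P1.  The ideal P0 records that P1 is nonzero. *)
Lemma prime_chain2_below_denom q P0 P1 P2 : noetherian R -> normal_domain R ->
    prime_ideal (denom_ideal q) -> P2 =i denom_ideal q ->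
    prime_ideal P1 -> {subset P0 <= P1} -> ~ {subset P1 <= P0} ->
    {subset P1 <= P2} -> {subset P2 <= P1}.
Proof.
move=> noethR normR primeD P2E [_ primeP1] P01 nP10 P12.
apply: contrapT => nP21.
have [t [u [Dt Du tu]]] := prime_denom_uniformizer noethR normR primeD.
have P1u (x : R) : (u * x : R^o) \in P1 -> (x : R^o) \in P1.
  move=> /primeP1/orP[/P12|//]; rewrite P2E => Pu.
  by rewrite Pu in Du.
have P1t : (t : R^o) \notin P1.
  apply/negP => P1t; apply: nP21 => z; rewrite P2E => /denom_idealP[w zw].
  by apply: P1u; rewrite (uniformizer_generates tu zw) ideal_mulr.
case: primeD => /negP D1 _; apply/D1/denom_ideal1.
apply: (@integral_of_stable_ideal R P1) => //.
  apply: contrapT => zeroP1; apply: nP10 => z P1z.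
  have [->|nz] := eqVneq z 0; first exact: rpred0.
  by case: zeroP1; exists z.
move=> z P1z; have := P12 _ P1z; rewrite P2E => /denom_idealP[w zw].
exists w => //; have := ideal_mull u P1z.
rewrite (uniformizer_generates tu zw) => /primeP1/orP[P1t'|//].
by rewrite P1t' in P1t.
Qed.

(** An ideal of height at least 2 cannot be contained in a proper denominator
    ideal D(q), as it would be contained in a prime D(c q). *)
Lemma height2_denom I q : noetherian R -> normal_domain R ->
  height_ge I 2 -> {subset I <= denom_ideal q} -> exists r, q = r%:F.
Proof.
move=> noethR normR htI ID; apply/denom_ideal1; apply: contrapT => D1.
have [||z Dz z1|c [primeD _]] := @denom_ideal_prime R (eq 1) q noethR.
- by [].
- by move=> x y <- <-; rewrite mulr1.
- by apply: D1; rewrite z1.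
have [x /ID/(ideal_mull c)|Ps [[primePs chainPs] Ps2]] := htI _ primeD.
  by rewrite denom_ideal_mul mulrC.
have [P01 nP10] := chainPs 0%N isT; have [P12 nP21] := chainPs 1%N isT.
apply: nP21.
exact: (prime_chain2_below_denom noethR normR primeD Ps2 (primePs 1%N isT) P01).
Qed.

Definition zero_ideal : submodClosed R^o := gen_submod (fun _ : R^o => False).

Lemma zero_idealP (x : R) : ((x : R^o) \in zero_ideal) = (x == 0).
Proof.
apply/idP/eqP => [|->]; last exact: rpred0.
case/asboolP=> [[|p t] [Gt ->]]; first by rewrite big_nil.
by case: (Gt p (mem_head _ _)).
Qed.

Lemma zero_ideal_prime : prime_ideal zero_ideal.
Proof.
by split=> [|x y]; rewrite !zero_idealP ?oner_eq0 // mulf_eq0.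
Qed.

Lemma height_gt0_neq0 I k : height_ge I k.+1 ->
  exists2 x : R, (x : R^o) \in I & x != 0.
Proof.
move=> htI; apply: contrapT => I0.
have [x Ix|Ps [[primePs chainPs] Psk]] := htI _ zero_ideal_prime.
  rewrite zero_idealP; apply: contraT => nzx; exfalso; apply: I0.
  by exists x.
have [_ []] := chainPs k (leqnn _).
move=> x; rewrite Psk zero_idealP => /eqP->; exact: rpred0.
Qed.

Lemma height_ge2P P P1 (a : R) : prime_ideal P -> prime_ideal P1 ->
  (a : R^o) \in P1 -> a != 0 ->
  {subset P1 <= P} -> ~ {subset P <= P1} -> prime_height_ge P 2.
Proof.
move=> primeP primeP1 P1a nza P1P nPP1.
exists (fun i => if i is k.+1 then if k is _.+1 then P else P1 else zero_ideal).
split=> //; split=> [[|[|i]] _|[|[|i]] //] //; first exact: zero_ideal_prime.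
move=> _; split=> [x|/(_ a P1a)]; rewrite zero_idealP; last by rewrite (negPf nza).
by move/eqP->; apply: rpred0.
Qed.

End Height.

(** * Minors *)

Section Minors.
Variable R : comNzRingType.

(** An increasing self-map of the row indices is a permutation, so a maximal minor
    is determined up to sign by its columns. *)
Lemma is_minor_colsub s n (A : 'M[R]_(s, n)) a : is_minor s A a ->
  exists k (g : 'I_s -> 'I_n), a = (-1) ^+ k * \det (colsub g A).
Proof.
case=> f [g [homf _ ->]].
have injf : injective f.
  move=> i j fij; apply: val_inj; case: (ltngtP i j) => // /homf;
  by rewrite fij ltnn.
exists (perm injf), g; rewrite -det_perm -det_mulmx -row_permE.
by congr (\det _); apply/matrixP=> i j; rewrite !mxE permE.
Qed.

(** Columns may be chosen in any order and with repetitions: repeated columns give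
    determinant 0, and otherwise the columns can be sorted. *)
Lemma det_colsub_mem s n (A : 'M[R]_(s, n)) (g : 'I_s -> 'I_n) :
  (\det (colsub g A) : R^o) \in det_ideal s A.
Proof.
have [injg|] := pselect (injective g); last first.
  move=> ninj; have [i [j ij gij]] : exists i, exists2 j, i != j & g i = g j.
    apply: contrapT => noij; apply: ninj => i j gij; apply/eqP/contraT => ij.
    by case: noij; exists i, j.
  rewrite -det_tr (determinant_alternate ij) ?rpred0 // => k.
  by rewrite !mxE gij.
(* The rank of [g i] among the values of g is the permutation that sorts g. *)
pose rk i := #|[set j | g j < g i]%N|.
have rk_lt i : (rk i < s)%N.
  rewrite -[X in (_ < X)%N]card_ord -cardsT; apply: proper_card.
  apply/properP; split; first exact: subsetT.
  by exists i; rewrite ?inE ?ltnn.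
have rk_le i j : (g i <= g j)%N -> (rk i <= rk j)%N.
  move=> gij; apply/subset_leq_card/subsetP => k; rewrite !inE => /leq_trans.
  exact.
have rk_mono i j : (g i < g j)%N -> (rk i < rk j)%N.
  move=> gij; apply: proper_card; apply/properP; split.
    by apply/subsetP => k; rewrite !inE => /ltn_trans; apply.
  by exists i; rewrite !inE ?ltnn.
have inj_rk : injective (fun i => Ordinal (rk_lt i)).
  move=> i j [rkij]; apply/injg/val_inj.
  by case: (ltngtP (g i) (g j)) => // /rk_mono; rewrite rkij ltnn.
pose p := perm inj_rk.
have -> : \det (colsub g A) = (-1) ^+ p * \det (mxsub id (g \o p^-1%g) A).
  rewrite mulrC -odd_permV -det_perm -det_mulmx -col_permE.
  by congr (\det _); apply/matrixP=> i j; rewrite !mxE /= permK.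
apply: ideal_mull; apply: mem_gen_submod; exists id, (g \o p^-1%g); split=> //.
move=> i j ij /=; rewrite ltnNge; apply/negP => /rk_le; apply/negP.
rewrite -ltnNge.
by have := ij; rewrite -{1}[i](permKV p) -{1}[j](permKV p) !permE.
Qed.

(** If the maximal minors vanish modulo a prime then so does some nontrivial
    combination of the rows.  By induction on the number of rows, some maximal
    minor of the rows other than row 0, on columns g, may be assumed outside P.
    Its cofactors along an additional column j do not depend on j; taken as
    coefficients, they produce at j the determinant on columns j, g, which is in
    P. *)
Lemma minors_in_prime (P : submodClosed R^o) s n (A : 'M[R]_(s, n)) :
    prime_ideal P -> (forall g : 'I_s -> 'I_n, (\det (colsub g A) : R^o) \in P) ->
  exists x : 'rV[R]_s, (exists i, (x 0 i : R^o) \notin P) /\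
    forall j, ((x *m A) 0 j : R^o) \in P.
Proof.
move=> primeP; elim: s A => [|s IHs] A minP.
  have g0 : 'I_0 -> 'I_n by case.
  by have := minP g0; rewrite det_mx00; case: primeP => /negPf->.
have [|] := pselect (forall g, (\det (colsub g (row' 0 A)) : R^o) \in P).
  case/IHs=> x [[i Pxi] xAP].
  exists (\row_k if unlift 0 k is Some k' then x 0 k' else 0); split.
    by exists (lift 0 i); rewrite mxE liftK.
  move=> j; rewrite mxE big_ord_recl !mxE unlift_none mul0r add0r.
  rewrite (eq_bigr (fun k => x 0 k * row' 0 A k j)) => [|k _].
    by have := xAP j; rewrite mxE.
  by rewrite !mxE liftK.
move/existsNP=> [g /negP nPg].
pose B j := colsub (fun k => if unlift 0 k is Some k' then g k' else j) A.
have cofB i j : cofactor (B j) i 0 = (-1) ^+ i * \det (colsub g (row' i A)).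
  rewrite /cofactor addn0; congr (_ * \det _); apply/matrixP=> k l.
  by rewrite !mxE liftK.
exists (\row_i ((-1) ^+ i * \det (colsub g (row' i A)))); split.
  by exists 0; rewrite mxE expr0 mul1r.
move=> j; have := minP (fun k => if unlift 0 k is Some k' then g k' else j).
rewrite -/(B j) (expand_det_col _ 0) mxE.
under eq_bigr => i _ do rewrite cofB mxE unlift_none mulrC.
by under [X in _ -> X \in P]eq_bigr => i _ do rewrite mxE.
Qed.

End Minors.

(** * The equivalence for matrices *)

Section Matrix.
Variable R : idomainType.

Lemma scale_row_inj n (a : R) : a != 0 -> injective (fun x : 'rV[R]_n => a *: x).
Proof.
move=> nza x y /rowP axy; apply/rowP=> j; apply: (mulfI nza).
by have := axy j; rewrite !mxE.
Qed.

(** Torsionfreeness of the cokernel of right multiplication by A. *)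
Definition saturated s n (A : 'M[R]_(s, n)) : Prop :=
  forall (r : R) (c : 'rV_s) (y : 'rV_n), r != 0 -> r *: y = c *m A ->
    exists c' : 'rV_s, y = c' *m A.

Lemma saturated_of_height s n (A : 'M[R]_(s, n)) :
  noetherian R -> normal_domain R -> height_ge (det_ideal s A) 2 ->
  (forall c : 'rV_s, c *m A = 0 -> c = 0) /\ saturated A.
Proof.
move=> noethR normR ht.
have colsubM (x : 'rV_s) (g : 'I_s -> 'I_n) :
    colsub g (x *m A) = x *m colsub g A.
  by apply/rowP=> j; rewrite !mxE; apply: eq_bigr => k _; rewrite !mxE.
split=> [c cA0|r c y nzr ryE].
  have [g nzg] : exists g : 'I_s -> 'I_n, \det (colsub g A) != 0.
    apply: contrapT => noG; have [x Ix /negP[]] := height_gt0_neq0 ht.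
    rewrite -zero_idealP.
    apply: (gen_submod_sub (P := zero_ideal R) _ Ix) => a.
    case/is_minor_colsub=> k [g ->]; apply: ideal_mull; rewrite zero_idealP.
    by apply: contraT => nzg; case: noG; exists g.
  have : c *m colsub g A *m \adj (colsub g A) = 0.
    by rewrite -colsubM cA0 -(mul0mx _ (\adj (colsub g A))); congr (_ *m _);
       apply/rowP=> j; rewrite !mxE.
  rewrite -mulmxA mul_mx_adj mul_mx_scalar => det0.
  by apply: (scale_row_inj nzg); rewrite /= det0 scaler0.
have nzrF : r%:F != 0 by rewrite tofrac_eq0.
(* Cramer: det(A_g) c / r = y_g adj(A_g), with A_g and y_g the columns g. *)
have div i : exists b : R, (c 0 i)%:F / r%:F = b%:F.
  apply: (height2_denom noethR normR ht); apply: gen_submod_sub => a.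
  case/is_minor_colsub=> k [g ->]; apply: ideal_mull; apply/denom_idealP.
  exists ((colsub g y *m \adj (colsub g A)) 0 i).
  apply: (mulIf nzrF); rewrite mulrA mulfVK // -!rmorphM; congr _%:F.
  have : r *: (colsub g y *m \adj (colsub g A)) = \det (colsub g A) *: c.
    rewrite -[RHS]mul_mx_scalar -mul_mx_adj mulmxA -colsubM -ryE scalemxAl.
    by congr (_ *m _); apply/rowP=> j; rewrite !mxE.
  by move/rowP/(_ i); rewrite !mxE mulrC => ->.
have [b bE] := choice div.
exists (\row_i b i); apply: (scale_row_inj nzr); rewrite ryE scalemxAl; congr (_ *m _).
apply/rowP=> i; rewrite !mxE; apply/eqP; rewrite -tofrac_eq tofracM -bE.
by rewrite mulrC mulfVK.
Qed.

Lemma height_of_saturated s n (A : 'M[R]_(s, n)) :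
  noetherian R -> normal_domain R ->
  (forall c : 'rV_s, c *m A = 0 -> c = 0) -> saturated A ->
  height_ge (det_ideal s A) 2.
Proof.
move=> noethR normR injA satA P primeP IP.
have [x [[i Pxi] PxA]] : exists x : 'rV[R]_s, (exists i, (x 0 i : R^o) \notin P)
    /\ forall j, ((x *m A) 0 j : R^o) \in P.
  by apply: minors_in_prime => // g; apply/IP/det_colsub_mem.
have [a Pa nza] : exists2 a : R, (a : R^o) \in P & a != 0.
  apply: contrapT => P0; move/negP: Pxi; apply.
  suff /injA->: x *m A = 0 by rewrite mxE rpred0.
  apply/rowP=> j; rewrite [RHS]mxE; apply/eqP/contraT => nz.
  by case: P0; exists ((x *m A) 0 j).
have nzaF : a%:F != 0 by rewrite tofrac_eq0.
have Dsub (z : R) : (z : R^o) \in denom_ideal (a%:F)^-1 -> (z : R^o) \in P.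
  case/denom_idealP=> w /(canRL (mulfVK nzaF)); rewrite -rmorphM => /eqP.
  by rewrite tofrac_eq => /eqP->; apply: ideal_mull.
(* Among the multiples of 1 / a, whose denominators are the multiples of a. *)
have [||z Dz|c [primeD DP]] :=
    @denom_ideal_prime R (fun z => (z : R^o) \notin P) (a%:F)^-1 noethR.
- by case: primeP.
- move=> z w Pz Pw; apply/negP; case: primeP => _ primeP /primeP.
  by rewrite (negPf Pz) (negPf Pw).
- by rewrite Dsub.
set q := c%:F * _ in primeD DP.
have {}DP : {subset denom_ideal q <= P} by move=> z /DP/negP; rewrite negbK.
have Da : (a : R^o) \in denom_ideal q.
  rewrite denom_ideal_mul; apply: ideal_mulr; apply/denom_idealP; exists 1.
  by rewrite mulfV // rmorph1.
apply: (height_ge2P primeP primeD Da nza) => // PD.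
have [t [u [Dt Du tu]]] := prime_denom_uniformizer noethR normR primeD.
have nzt : t != 0.
  apply: contraNneq Du => t0; move: tu; rewrite t0 rmorph0 mul0r => /esym/eqP.
  by rewrite tofrac_eq0 => /eqP->; apply: rpred0.
have quot j : exists w : R, u * (x *m A) 0 j = t * w.
  have /PD/denom_idealP[w xw] := PxA j; exists w.
  exact: uniformizer_generates tu xw.
have [w wE] := choice quot.
have [|c' yE] := satA t (u *: x) (\row_j w j) nzt.
  by rewrite -scalemxAl; apply/rowP=> j; rewrite [RHS]mxE wE !mxE.
have /injA/eqP : (u *: x - t *: c') *m A = 0.
  rewrite mulmxBl -!scalemxAl -yE; apply/eqP; rewrite subr_eq0; apply/eqP.
  by apply/rowP=> j; rewrite [LHS]mxE wE !mxE.
rewrite subr_eq0 => /eqP/rowP/(_ i); rewrite !mxE => uxE.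
have : (u * x 0 i : R^o) \in P by rewrite uxE; apply: ideal_mulr; apply: DP.
case: primeP => _ primeP /primeP/orP[/PD|]; first by rewrite (negPf Du).
by rewrite (negPf Pxi).
Qed.

End Matrix.

(** * Torsionfree modules *)

Section FreeModuleLift.
Variables (R : comNzRingType) (K : choiceType) (V : lmodType R) (f : K -> V).

Lemma fglift_is_linear : linear (fglift f : {freeg K / R} -> V).
Proof.
have additive_fglift := lift_is_additive f.
have fgliftN x : fglift f (- x) = - fglift f x.
  by rewrite -[- x]sub0r additive_fglift -(subrr x) additive_fglift subrr sub0r.
have fgliftD x y : fglift f (x + y) = fglift f x + fglift f y.
  by rewrite -[y in LHS]opprK additive_fglift fgliftN opprK.
have fglift_sum (t : seq K) (c : K -> R) :
    fglift f (\sum_(k <- t) << c k *g k >>) = \sum_(k <- t) c k *: f k.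
  elim: t => [|k t IHt]; last by rewrite !big_cons fgliftD IHt liftU.
  by rewrite !big_nil -(subrr 0) additive_fglift subrr.
move=> a x y; rewrite fgliftD; congr (_ + _).
have xE : fglift f x = \sum_(k <- freeg.dom x) freeg.coeff k x *: f k.
  by rewrite -{1}[x]freeg_sumE fglift_sum.
rewrite xE scaler_sumr [LHS](fglift_sum _ (fun k => a * freeg.coeff k x)).
by apply: eq_bigr => k _; rewrite scalerA.
Qed.

HB.instance Definition _ :=
  GRing.isLinear.Build R {freeg K / R} V _ (fglift f) fglift_is_linear.

End FreeModuleLift.

Section Torsion.
Variables (R : idomainType) (N : lmodType R).
Implicit Types (q : {fraction R}).

(** The value 0 when b is not a denominator of q is arbitrary; only values at
    denominators are used. *)
Definition numerator (b : R) q : R :=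
  if pselect (exists a : R, b%:F * q = a%:F) is left ex then projT1 (cid ex)
  else 0.

Lemma numeratorE (b a : R) q : b%:F * q = a%:F -> numerator b q = a.
Proof.
move=> bq; rewrite /numerator; case: pselect => [ex|[]]; last by exists a.
case: (cid ex) => a' /=; rewrite bq => /eqP.
by rewrite tofrac_eq => /eqP.
Qed.

(** A pair (q, n) stands for the element q n of the localization of N; its multiple
    by a common denominator b can be computed in N itself. *)
Definition scaled_tensor (b : R) (p : fracmod R * N) : N :=
  numerator b p.1 *: p.2.

(** Any one tensor relation is respected as soon as b is a common denominator of
    the fractions that it mentions.  The factor e allows one b to serve
    finitely many relations. *)
Lemma scaled_tensor_rel (w : {freeg (fracmod R * N)%type / R}) : tensor_rel w ->
  exists2 b : R, b != 0 & forall e, fglift (scaled_tensor (e * b)) w = 0.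
Proof.
have mulE (e b a : R) q : b%:F * q = a%:F -> (e * b)%:F * q = (e * a)%:F.
  by move=> bq; rewrite !tofracM -mulrA bq.
case=> [q q' n|q n n'|r q n|r q n].
- have [b nzb [a bq]] := frac_denominator q.
  have [b' nzb' [a' bq']] := frac_denominator q'.
  exists (b * b') => [|e]; first exact: mulf_neq0.
  rewrite !linearB /= !liftU !scale1r /scaled_tensor /=.
  have qE : (e * (b * b'))%:F * q = (e * b' * a)%:F.
    by rewrite [b * b']mulrC [X in X%:F]mulrA (mulE _ _ _ _ bq).
  have qE' : (e * (b * b'))%:F * q' = (e * b * a')%:F.
    by rewrite [X in X%:F]mulrA (mulE _ _ _ _ bq').
  rewrite (numeratorE qE) (numeratorE qE').
  rewrite (@numeratorE _ (e * b' * a + e * b * a')).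
    by rewrite scalerDl addrAC addrK subrr.
  by rewrite mulrDr tofracD qE qE'.
- have [b nzb _] := frac_denominator q.
  exists b => // e; rewrite !linearB /= !liftU !scale1r /scaled_tensor /=.
  by rewrite scalerDr addrAC addrK subrr.
- have [b nzb [a bq]] := frac_denominator q.
  exists b => // e; rewrite linearB linearZ /= !liftU !scale1r /scaled_tensor /=.
  have qE := mulE e _ _ _ bq.
  rewrite (numeratorE qE) (@numeratorE _ (r * (e * a))) ?scalerA ?subrr //.
  by rewrite [RHS]tofracM -qE; apply: mulrCA.
- have [b nzb _] := frac_denominator q.
  exists b => // e; rewrite linearB linearZ /= !liftU !scale1r /scaled_tensor /=.
  by rewrite !scalerA mulrC subrr.
Qed.

Lemma tens_scale (r : R) (a : fracmod R) (x : N) :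
  tens (r *: a) x = tens a (r *: x).
Proof.
transitivity (quotmod_proj (gen_submod (@tensor_rel R (fracmod R) N))
                (r *: << (a, x) >>)); [|apply/esym];
  apply/pi_quotmod_eq/mem_gen_submod; [exact: TensorZl | exact: TensorZr].
Qed.

(** If 1 tensor x = 1 tensor y, the difference of the two generators is a
    combination of finitely many relations; for b a common denominator of the
    fractions in them, [scaled_tensor b] kills the combination and sends the
    difference to b (x - y).  Thus the kernel of N -> Frac(R) tensor N is the
    torsion of N, without identifying the tensor product with a localization. *)
Lemma torsionfreeP :
  torsionfree N <-> forall (r : R) (x : N), r != 0 -> r *: x = 0 -> x = 0.
Proof.
split=> [injN r x nzr rx0|noTor x y].
  apply: injN; rewrite /=.
  have nzrF : r%:F != 0 by rewrite tofrac_eq0.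
  have <- : r *: (r%:F^-1 : fracmod R) = 1 by apply: mulfV.
  by rewrite !tens_scale rx0 scaler0.
move=> /pi_quotmod_eq/asboolP[t [relt sumt]].
have [b nzb bt] : exists2 b : R, b != 0 & forall e p, p \in t ->
    fglift (scaled_tensor (e * b)) p.2 = 0.
  elim: t relt {sumt} => [|p t IHt] relt; first by exists 1; rewrite ?oner_neq0.
  have [|b nzb bt] := IHt; first by move=> p' p't; apply: relt; rewrite inE p't orbT.
  have [b' nzb' bp] := scaled_tensor_rel (relt p (mem_head _ _)).
  exists (b * b') => [|e p']; first exact: mulf_neq0.
  rewrite inE => /predU1P[->|p't]; first by rewrite mulrA bp.
  by rewrite [b * b']mulrC mulrA bt.
apply/eqP; rewrite -subr_eq0; apply/eqP/(noTor b) => //.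
have := congr1 (fglift (scaled_tensor (1 * b))) sumt.
rewrite linear_sum /= big_seq big1 => [|p pt]; last first.
  by rewrite linearZ /= bt ?scaler0.
rewrite linearB /= !liftU !scale1r /scaled_tensor /= mul1r.
by rewrite (@numeratorE b b) ?mulr1 // -scalerBr.
Qed.

End Torsion.

Lemma torsionfree_coker (R : idomainType) (U V : lmodType R)
    (f : {linear U -> V}) :
  torsionfree (coker f) <->
  forall (r : R) (x : V), r != 0 -> (exists u, f u = r *: x) ->
    exists u, f u = x.
Proof.
have proj0 x : quotmod_proj (image_submod f) x = 0 <-> exists u, f u = x.
  rewrite -(linear0 (quotmod_proj (image_submod f))) pi_quotmod_eq subr0.
  by split=> /asboolP.
rewrite torsionfreeP; split=> [noTor r x nzr|sat r].
  move=> /proj0; rewrite linearZ => /(noTor _ _ nzr)/proj0; exact.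
elim/quotW=> x nzr; rewrite -[\pi_ _ x]/(quotmod_proj (image_submod f) x).
by rewrite -linearZ => /proj0/(sat _ _ nzr)/proj0.
Qed.

(** * Coordinates *)

Section Bases.
Variables (R : comNzRingType) (V : lmodType R) (n : nat) (e : 'I_n -> V).

Definition lincomb (c : 'rV[R]_n) : V := \sum_j c 0 j *: e j.

Lemma lincombZ a c : lincomb (a *: c) = a *: lincomb c.
Proof.
by rewrite /lincomb scaler_sumr; apply: eq_bigr => j _; rewrite mxE scalerA.
Qed.

Lemma basis_lincomb_inj : is_basis e -> injective lincomb.
Proof.
move=> basis_e c c' cc'; have [c0 [_ uniq_c0]] := basis_e (lincomb c).
by rewrite -(uniq_c0 c) // (uniq_c0 c').
Qed.

Lemma basis_lincomb_surj : is_basis e -> forall x, exists c, x = lincomb c.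
Proof. by move=> basis_e x; have [c [xE _]] := basis_e x; exists c. Qed.

End Bases.

Lemma represents_mulmx (R : comNzRingType) (U V : lmodType R) s n
    (d : 'I_s -> U) (e : 'I_n -> V) (f : {linear U -> V}) (A : 'M[R]_(s, n)) :
  represents d e f A -> forall c, f (lincomb d c) = lincomb e (c *m A).
Proof.
case=> _ _ fE c; rewrite /lincomb linear_sum.
under eq_bigr => i _ do rewrite linearZ /= fE scaler_sumr.
rewrite exchange_big; apply: eq_bigr => j _; rewrite mxE scaler_suml.
by apply: eq_bigr => i _; rewrite scalerA.
Qed.

Theorem theorem4p2 (R : idomainType) (M F X : lmodType R) (s n : nat)
    (phi : {linear 'rV[R]_s -> M}) (iota : {linear M -> F})
    (pi : {linear F -> X}) (d : 'I_s -> 'rV[R]_s) (e : 'I_n -> F)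
    (A : 'M[R]_(s, n)) :
  noetherian R -> normal_domain R -> krull_dim_ge R 2 ->
  fin_gen M -> reflexive_module M ->
  fin_free F -> torsionfree X -> short_exact iota pi ->
  represents d e (iota \o phi) A ->
  (injective phi /\ torsionfree (coker phi)) <-> height_ge (det_ideal s A) 2.
Proof.
move=> noethR normR _ _ _ _ /torsionfreeP noTorX [inj_iota exactF _] repA.
have [basis_d basis_e _] := repA.
have psiE := represents_mulmx repA.
have inj_e := basis_lincomb_inj basis_e; have inj_d := basis_lincomb_inj basis_d.
rewrite torsionfree_coker; split=> [[inj_phi satphi]|].
  apply: height_of_saturated => // [c cA0|r c y nzr ryE].
    apply/inj_d/inj_phi/inj_iota; rewrite -[LHS]/((iota \o phi) _).
    rewrite -[RHS]/((iota \o phi) _) !psiE cA0.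
    by rewrite mul0mx.
  (* As X is torsionfree, the vector y comes from an element m of M. *)
  have piy0 : pi (lincomb e y) = 0.
    apply: (noTorX r) => //; rewrite -linearZ -lincombZ ryE -psiE.
    by apply/exactF; exists (phi (lincomb d c)).
  have /exactF[m mE] := piy0.
  have [|v vE] := satphi r m nzr.
    exists (lincomb d c); apply: inj_iota; rewrite [RHS]linearZ /= mE -lincombZ ryE.
    exact: psiE.
  have [c' c'E] := basis_lincomb_surj basis_d v.
  by exists c'; apply: inj_e; rewrite -mE -vE c'E; apply: psiE.
move=> /(saturated_of_height noethR normR)[injA satA]; split.
  move=> v w; have [c ->] := basis_lincomb_surj basis_d v.
  have [c' ->] := basis_lincomb_surj basis_d w => /(congr1 iota).
  move=> vw; have /inj_e/eqP : lincomb e (c *m A) = lincomb e (c' *m A).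
    by rewrite -!psiE.
  rewrite -subr_eq0 -mulmxBl => /eqP/injA/eqP.
  by rewrite subr_eq0 => /eqP->.
move=> r m nzr [v vE]; have [c cE] := basis_lincomb_surj basis_d v.
have [y yE] := basis_lincomb_surj basis_e (iota m).
have [|c' c'E] := satA r c y nzr.
  by apply: inj_e; rewrite lincombZ -yE -linearZ -vE cE -psiE.
by exists (lincomb d c'); apply: inj_iota; rewrite yE c'E; apply: psiE.
Qed.
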